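(* Let $n\ge 1$ and $m\ge 1$ be integers, and let $G=([n],E(G))$ be a simple graph with complement $\bar G$. Let $$\mathcal C_n^m(G)=\mathcal C_n^m\setminus\{x_i-x_j=0\mid \{i,j\}\in E(G)\}$$ be the graph-deleted Catalan arrangement in $\mathbb R^n$. Then its characteristic polynomial is $$\chi(\mathcal C_n^m(G),t)=t\sum_{k=1}^{n}\mathrm{Stir}_k(\bar G)\,(t-mk-1)^{\underline{k-1}}.$$
   Context: Notation: $[n]=\{1,\dots,n\}$. Falling factorial: $x^{\underline r}=x(x-1)\cdots(x-r+1)$, $x^{\underline 0}=1$. The full $m$-Catalan arrangement in $\mathbb R^n$ is the set of hyperplanes $$\mathcal C_n^m=\{x_i-x_j=0\mid 1\le i<j\le n\}\cup\{x_i-x_j=s\mid 1\le i\ne j\le n,\ 1\le s\le m\}.$$ For a finite hyperplane arrangement $\mathcal A$ in $\mathbb R^n$, $L(\mathcal A)$ is the poset of nonempty intersections of subfamilies of $\mathcal A$, ordered by reverse inclusion, with minimum $\hat 0=\mathbb R^n$ (the empty intersection). With $\mu$ the Möbius function of $L(\mathcal A)$, the characteristic polynomial is $\chi(\mathcal A,t)=\sum_{X\in L(\mathcal A)}\mu(\hat 0,X)t^{\dim X}$. For a simple graph $H$, the graphical Stirling number $\mathrm{Stir}_k(H)$ is the number of partitions of the vertex set of $H$ into $k$ nonempty independent sets (an independent set is a set of vertices no two of which are adjacent). $\bar G$ is the usual complement of $G$ on the same vertex set. *)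

(* Defs.v *)
From HB Require Import structures.
From mathcomp Require Import all_boot all_order all_algebra finmap.
From mathcomp Require Import boolp classical_sets reals.

Set Implicit Arguments.
Unset Strict Implicit.
Unset Printing Implicit Defensive.

Import Order.TTheory GRing.Theory Num.Theory.
Local Open Scope ring_scope.

Section Moebius.
Context {d : Order.disp_t} {P : finPOrderType d}.
Implicit Types x y z : P.

(* The fuel bounds the length of a chain below y; #|P| is enough, as
   moebiusE shows. *)
Fixpoint moebius_rec (fuel : nat) x y : int :=
  if fuel is f.+1 then
    if x == y then 1
    else if (x < y)%O then - \sum_(z : P | (x <= z < y)%O) moebius_rec f x z
    else 0
  else 0.

Definition moebius x y : int := moebius_rec #|P| x y.

Lemma moebius_rec_enough f g x y :
    (#|[pred z | (z <= y)%O]| <= f)%N -> (#|[pred z | (z <= y)%O]| <= g)%N ->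
  moebius_rec f x y = moebius_rec g x y.
Proof.
have pos (w : P) : (0 < #|[pred z | (z <= w)%O]|)%N.
  by apply/card_gt0P; exists w; rewrite inE.
elim: f g y => [|f IHf] [|g] y; rewrite ?leqn0 => hf hg.
- by [].
- by move: (pos y); rewrite (eqP hf).
- by move: (pos y); rewrite (eqP hg).
rewrite /=; case: eqP => // _; case: ifP => // _.
congr (- _); apply: eq_bigr => z /andP[_ ltzy].
have ltc : (#|[pred w | (w <= z)%O]| < #|[pred w | (w <= y)%O]|)%N.
  apply: proper_card; apply/properP; split.
    by apply/fintype.subsetP=> w; rewrite !inE => /le_trans; apply; apply: ltW.
  by exists y; rewrite !inE // lt_geF.
by apply: IHf; rewrite -ltnS (leq_trans ltc).
Qed.

Lemma moebiusE x y : moebius x y =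
  if x == y then 1
  else if (x < y)%O then - \sum_(z : P | (x <= z < y)%O) moebius x z
  else 0.
Proof.
rewrite {1}/moebius (@moebius_rec_enough _ #|P|.+1) ?max_card //.
by rewrite (leq_trans (max_card _)).
Qed.

End Moebius.

Section CharPoly.
Context {R : realFieldType} {n : nat}.
Local Open Scope classical_set_scope.

Definition arrangement := {fset set 'rV[R]_n}.

Implicit Type A : arrangement.

Definition intersections A : {fset set 'rV[R]_n} :=
  [fset \bigcap_(H in [set` B]) H | B : {fset set 'rV[R]_n} in fpowerset A]%fset.

Definition flats A : {fset set 'rV[R]_n} :=
  [fset X in intersections A | `[< X !=set0 >]]%fset.

Definition intersection_poset A : Type := flats A.

HB.instance Definition _ A := Finite.on (intersection_poset A).

Section Order.
Variable A : arrangement.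

Definition flat_le (X Y : intersection_poset A) : bool :=
  `[< val Y `<=` val X >].

Fact flat_le_refl : reflexive flat_le.
Proof. by move=> X; apply/asboolP. Qed.

Fact flat_le_anti : antisymmetric flat_le.
Proof.
by move=> X Y /andP[/asboolP YX /asboolP XY]; apply/val_inj/seteqP.
Qed.

Fact flat_le_trans : transitive flat_le.
Proof.
move=> Y X Z /asboolP YX /asboolP ZY; apply/asboolP; exact: subset_trans YX.
Qed.

Fact setT_flat : [set: 'rV[R]_n] \in flats A.
Proof.
rewrite !inE; apply/andP; split; last by apply/asboolP; exists 0.
apply/imfsetP; exists fset0 => /=; first by rewrite fpowersetE fsub0set.
by apply/esym/seteqP; split=> // x _ H /=; rewrite inE.
Qed.

Definition flat0 : intersection_poset A := [` setT_flat]%fset.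

Fact flat0_le (X : intersection_poset A) : flat_le flat0 X.
Proof. exact/asboolP. Qed.

End Order.

Fact flat_display : Order.disp_t. Proof. by []. Qed.

HB.instance Definition _ A :=
  Order.Le_isPOrder.Build flat_display (intersection_poset A)
    (@flat_le_refl A) (@flat_le_anti A) (@flat_le_trans A).

HB.instance Definition _ A :=
  Order.hasBottom.Build flat_display (intersection_poset A) (@flat0_le A).

(* The dimension of the direction space U of the affine subspace X = p + U
   (junk value 0 if X is not an affine subspace). *)
Definition affine_dim (X : set 'rV[R]_n) : nat :=
  \dim (xget 0%VS
    [set U : {vspace 'rV[R]_n} |
       exists p, X = [set p + u | u in [set` U]]]).

Definition characteristic_poly A : {poly int} :=
  \sum_(X : intersection_poset A) moebius \bot%O X *: 'X^(affine_dim (val X)).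

End CharPoly.

Arguments arrangement R n : clear implicits.

Section Catalan.
Variables (R : realFieldType) (n : nat).

(* Coordinates are indexed by 0, ..., n-1. *)
Definition hyp (i j : 'I_n) (s : nat) : set 'rV[R]_n :=
  [set x | x 0 i - x 0 j = s%:R]%classic.

Definition catalan (m : nat) : arrangement R n :=
  ([fset hyp i j 0 | i : 'I_n, j : 'I_n & (val i < val j)%N] `|`
   \bigcup_(s <- iota 1 m) [fset hyp i j s | i : 'I_n, j : 'I_n & i != j])%fset.

Definition graph_catalan (m : nat) (e : rel 'I_n) : arrangement R n :=
  (catalan m `\` [fset hyp i j 0 | i : 'I_n, j : 'I_n & e i j])%fset.

End Catalan.

Section Graphs.
Variable T : finType.

Definition simple_graph (e : rel T) : Prop := symmetric e /\ irreflexive e.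

Definition compl_graph (e : rel T) : rel T :=
  fun x y => (x != y) && ~~ e x y.

Definition independent (e : rel T) (B : {set T}) : bool :=
  [forall x in B, forall y in B, ~~ e x y].

Definition Stir (k : nat) (e : rel T) : nat :=
  #|[set P : {set {set T}} |
     [&& finset.partition P [set: T], #|P| == k & [forall B in P, independent e B]]]|.

End Graphs.

Definition falling (A : pzRingType) (x : A) (r : nat) : A :=
  \prod_(i < r) (x - i%:R).

(* Main.v *)
Require Import Defs.
From mathcomp Require Import boolp classical_sets.
From mathcomp Require Import all_boot all_order all_algebra reals finmap.
From mathcomp Require Import zify.
Import Order.TTheory GRing.Theory Num.Theory.

Set Implicit Arguments.
Unset Strict Implicit.
Unset Printing Implicit Defensive.

(** Both sides are polynomials over the integers, so it is enough that they
    agree at every large natural number q (eq_poly_nat).  The value at q is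
    obtained by counting points of (Z/q)^n, for any large q, prime or not.

    Left-hand side.  If y is a real point, the sum of mu(0, X) over the flats X
    containing y is the sum over the interval from 0 to the smallest flat
    through y, hence it is 1 if y lies on no hyperplane and 0 otherwise
    (moebius_sum_point).  Give every x in (Z/q)^n an integral point y(x) that
    satisfies x_i - x_j = s, for 0 <= s <= m, over the integers exactly when x
    satisfies it modulo q.  When q is large such a lift exists (cyclic_lift):
    some m consecutive places of the circle Z/q contain no coordinate of x, and
    cutting the circle there does not separate two coordinates at distance at
    most m.  A flat X consists of the translates,
    by one of its points, of the vectors that are constant on the components
    of a graph; its dimension is the number c of components.  Taking integral
    parts of a point of X gives a base point modulo q as well, so exactly q^c
    of the points y(x) lie in X (flat_count).  Summing over X and exchanging
    the sums, the characteristic polynomial at q is the number of x in (Z/q)^n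
    that avoid all the equations modulo q (characteristic_poly_count).

    Right-hand side.  The fibres of an avoiding x form a partition of the
    vertices into cliques of G, that is, independent sets of the complement.
    For a partition into k blocks, the x with these fibres are the placements
    of k labelled points on the circle Z/q with consecutive distances larger
    than m (card_kernel_fiber).  Rotating, one point may be put at 0, which
    gives a factor q; then the m places that follow each of the k points can be
    deleted, which leaves an injection into a set of q - mk places with one
    value prescribed.  So there are q (q - mk - 1)(q - mk - 2)...(q - mk - k + 1)
    placements (card_cyclic_separated). *)

(** * Separated points on a line *)

Section Separated.
Variables (K : finType) (m : nat).
Implicit Types f g : K -> nat.

Definition rank f i := #|[set j | f j < f i]|.

Definition separated f := forall i j, f i < f j -> f i + m < f j.

(** Each point below b occupies itself and the m places after it, all of them
    below b.  The induction removes the largest point l below b, and continues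
    with f l in place of b.  The hypothesis on b holds both for a value of f
    and for a right end of the line at distance more than m from all points. *)
Lemma separated_gap f i b : injective f -> separated f ->
    (forall l, f l < b -> f l + m < b) -> f i < b ->
  f i + m * #|[set l | f i <= f l < b]| < b.
Proof.
move=> injf sepf; elim/ltn_ind: b => b IHb gapb ltib.
have [l ltlb maxl] := @arg_maxnP K i (fun l => f l < b) f ltib.
have {}maxl l' : f l' < b -> f l' <= f l by exact: maxl.
have -> : [set l | f i <= f l < b] = l |: [set l' | f i <= f l' < f l].
  apply/setP=> l'; rewrite !inE; have [->|neq] := eqVneq l' l.
    by rewrite ltlb maxl.
  have : f l' != f l by rewrite (inj_eq injf).
  have := maxl l'; case: (ltnP (f l') b) => //=; lia.
rewrite cardsU1 inE ltnn andbF /=.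
have gapl := gapb l ltlb.
have [eqil|neqil] := eqVneq i l.
  rewrite -eqil in gapl *; rewrite (_ : [set _ | _] = set0) ?cards0; first lia.
  by apply/setP=> l'; rewrite !inE; lia.
have : f i != f l by rewrite (inj_eq injf).
have := maxl i ltib => leil neq.
have := IHb (f l) ltlb (fun l' => @sepf l' l); lia.
Qed.

Lemma rank_mono f g : (forall i j, (f i < f j) = (g i < g j)) ->
  rank f =1 rank g.
Proof. by move=> fg i; apply: eq_card => j; rewrite !inE fg. Qed.

Lemma rank_lt f i : rank f i < #|K|.
Proof.
apply: (leq_ltn_trans (n := #|[set~ i]|)).
  apply: subset_leq_card; apply/subsetP => j; rewrite !inE.
  by apply: contraTneq => ->; rewrite ltnn.
by rewrite cardsC1 prednK //; apply/card_gt0P; exists i.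
Qed.

Lemma rank0 f i : f i = 0 -> rank f i = 0.
Proof.
by move=> fi0; apply/eqP; rewrite cards_eq0; apply/eqP/setP=> j; rewrite !inE fi0.
Qed.

Lemma rank_leq f i j : f i <= f j -> rank f i <= rank f j.
Proof.
move=> leij; apply: subset_leq_card; apply/subsetP => l; rewrite !inE.
by move/leq_trans; apply.
Qed.

Lemma rank_add f i j : f i <= f j ->
  rank f j = rank f i + #|[set l | f i <= f l < f j]|.
Proof.
move=> leij; rewrite /rank -cardsUI (_ : _ :&: _ = set0).
  by rewrite cards0 addn0; apply: eq_card => l; rewrite !inE; lia.
by apply/setP=> l; rewrite !inE; lia.
Qed.

(** Insertion of m places after each point, and its inverse. *)
Definition spread g i := g i + m * rank g i.
Definition squeeze f i := f i - m * rank f i.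

Lemma spread_lt g i j : g i < g j -> spread g i + m < spread g j.
Proof.
move=> ltij; rewrite /spread (rank_add (ltnW ltij)).
have : 0 < #|[set l | g i <= g l < g j]|.
  by apply/card_gt0P; exists i; rewrite inE leqnn.
nia.
Qed.

Lemma spread_mono g i j : (spread g i < spread g j) = (g i < g j).
Proof.
apply/idP/idP; last by move/spread_lt; lia.
apply: contraTT; rewrite -!leqNgt => leji.
by rewrite leq_add // leq_mul // rank_leq.
Qed.

Lemma spreadK g : squeeze (spread g) =1 g.
Proof.
by move=> i; rewrite /squeeze (rank_mono (spread_mono g)) addnK.
Qed.

(** A point at 0 ensures that the truncated subtraction in squeeze is exact:
    the points of smaller rank then occupy the places from 0 on. *)
Section Squeeze.
Variables (f : K -> nat) (i0 : K).
Hypotheses (injf : injective f) (sepf : separated f) (f0 : f i0 = 0).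

Lemma squeeze_leq i : m * rank f i <= f i.
Proof.
have [->|neq] := eqVneq i i0; first by rewrite rank0 ?muln0.
have lt0i : f i0 < f i by rewrite f0 lt0n -f0 (inj_eq injf).
have := separated_gap injf sepf (fun l => @sepf l i) lt0i.
by rewrite f0 add0n => /ltnW.
Qed.

Lemma squeeze_lt i j : f i < f j -> squeeze f i < squeeze f j.
Proof.
move=> ltij; have := separated_gap injf sepf (fun l => @sepf l j) ltij.
have := squeeze_leq i; have := squeeze_leq j.
rewrite /squeeze (rank_add (ltnW ltij)); nia.
Qed.

Lemma squeeze_mono i j : (squeeze f i < squeeze f j) = (f i < f j).
Proof.
apply/idP/idP; last exact: squeeze_lt.
apply: contraTT; rewrite -!leqNgt leq_eqVlt => /orP[/eqP/injf->//|].
by move/squeeze_lt/ltnW.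
Qed.

Lemma squeezeK : spread (squeeze f) =1 f.
Proof.
by move=> i; rewrite /spread (rank_mono squeeze_mono) subnK ?squeeze_leq.
Qed.

Lemma squeeze_bound b i : (forall l, f l + m < b) -> squeeze f i < b - m * #|K|.
Proof.
move=> ltb.
have := @separated_gap f i b injf sepf (fun l _ => ltb l)
  (leq_ltn_trans (leq_addr _ _) (ltb i)).
have := squeeze_leq i; rewrite /squeeze.
have -> : #|K| = rank f i + #|[set l | f i <= f l < b]|.
  rewrite /rank -cardsUI (_ : _ :&: _ = set0).
    rewrite cards0 addn0 -cardsT; apply: eq_card => l; rewrite !inE.
    by have := ltb l; lia.
  by apply/setP=> l; rewrite !inE; lia.
nia.
Qed.
End Squeeze.
End Separated.

Local Open Scope ring_scope.

(** * Separated points on a circle *)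

(** Each of the #|V| possible values at i0 is brought to 0 by a translation. *)
Lemma card_pinned (K : finType) (V : finZmodType) (F : pred {ffun K -> V})
    (i0 : K) :
    (forall (f : {ffun K -> V}) c, F [ffun i => f i + c] = F f) ->
  #|[set f | F f]| = (#|V| * #|[set f : {ffun K -> V} | F f && (f i0 == 0%R)]|)%N.
Proof.
move=> Finv.
rewrite -sum1dep_card (partition_big (fun f : {ffun K -> V} => f i0) xpredT) //=.
rewrite -sum_nat_const; apply: eq_big => // c _; rewrite sum1dep_card.
have shift_inj (b : V) :
    injective (fun f : {ffun K -> V} => [ffun i => f i + b] : {ffun K -> V}).
  by move=> f g /ffunP fg; apply/ffunP=> i; move: (fg i); rewrite !ffunE => /addIr.
rewrite -[RHS](card_imset _ (@shift_inj c)); apply: eq_card => f.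
rewrite inE; apply/andP/imsetP => [[Ff /eqP fc]|[g + ->]].
  exists [ffun i => f i - c].
    rewrite !inE ffunE fc subrr eqxx.
    by rewrite -[X in X && _]/(F [ffun i => f i + - c]) Finv Ff.
  by apply/ffunP=> i; rewrite !ffunE subrK.
by rewrite !inE ffunE Finv => /andP[-> /eqP ->]; rewrite add0r.
Qed.

(** All injections are counted by a falling factorial, and those pinned at i0
    are a proportion 1 / M.+1 of them by rotation. *)
Lemma card_pinned_injections (K : finType) (M : nat) (i0 : K) :
  #|[set g : {ffun K -> 'I_M.+1} | injectiveb g && (g i0 == 0)]| = M ^_ #|K|.-1.
Proof.
apply/eqP; rewrite -(eqn_pmul2l (ltn0Sn M)) -[X in (X * _)%N == _](card_ord M.+1).
rewrite -card_pinned; last first.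
  move=> f c; apply/injectiveP/injectiveP => injf i j; move: (@injf i j).
    by rewrite !ffunE => ij e; apply: ij; rewrite e.
  by rewrite !ffunE => ij e; apply: ij; apply: addIr e.
rewrite card_inj_ffuns card_ord.
have : (0 < #|K|)%N by apply/card_gt0P; exists i0.
by case: #|K| => // k _; rewrite ffactnS.
Qed.

Section Cyclic.
Variables (K : finType) (m p : nat).
Implicit Types f : {ffun K -> 'I_p.+2}.

Definition cyclic_separated f :=
  [forall i, forall j, forall s : 'I_m.+1, (i != j) ==> (f i - f j != s%:R)].

Lemma cyclic_separatedP f :
  reflect (forall i j s, i != j -> (s <= m)%N -> f i - f j != s%:R)
          (cyclic_separated f).
Proof.
apply: (iffP idP) => [/forallP sepf i j s neq lesm|sepf].
  have /forallP/(_ (Ordinal (lesm : (s < m.+1)%N))) := forallP (sepf i) j.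
  by rewrite neq.
apply/forallP=> i; apply/forallP=> j; apply/forallP=> s; apply/implyP=> neq.
by apply: sepf; rewrite // -ltnS.
Qed.

Lemma val_natr s : (s < p.+2)%N -> val (s%:R : 'I_p.+2) = s.
Proof. by move=> lts; rewrite Zp_nat /= modn_small. Qed.

(** The residues being represented below p.+2, an equality modulo p.+2 between
    a and b + s is an equality up to at most one turn. *)
Lemma subr_natrP (a b : 'I_p.+2) s : (s < p.+2)%N ->
  (a - b == s%:R) = ((val a == val b + s)%N || (val a + p.+2 == val b + s)%N).
Proof.
move=> lts; rewrite subr_eq addrC -(inj_eq val_inj) /= val_natr //.
have lta := ltn_ord a; have ltb := ltn_ord b.
case: (ltnP (b + s) p.+2) => h; first by rewrite modn_small //; lia.
rewrite -[X in (X %% _)%N](subnK h) modnDr modn_small; lia.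
Qed.

Section Pinned.
Variable i0 : K.
Hypothesis large : (m * #|K| + m < p.+2)%N.

(* M.+1 places of the p.+2 remain when m of them are deleted after each point. *)
Let M := (p.+1 - m * #|K|)%N.

Definition spread_ffun (g : {ffun K -> 'I_M.+1}) : {ffun K -> 'I_p.+2} :=
  [ffun i => inord (spread m (fun j => val (g j)) i)].

(** The last m places stay free, so that points separated on the line remain
    separated when its ends are joined into a circle. *)
Lemma spread_bound (g : {ffun K -> 'I_M.+1}) i :
  (spread m (fun j => val (g j)) i + m < p.+2)%N.
Proof.
have lerm : (m * rank (fun j => val (g j)) i + m <= m * #|K|)%N.
  by rewrite -mulnSr leq_mul2l rank_lt orbT.
by move: lerm (ltn_ord (g i)) large; rewrite /spread /M /=; lia.
Qed.

Lemma spread_ffunE g i : val (spread_ffun g i) = spread m (fun j => val (g j)) i.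
Proof.
rewrite ffunE /= inordK //; apply: leq_ltn_trans (leq_addr m _) _.
exact: spread_bound.
Qed.

Lemma spread_ffun_bound g i : (val (spread_ffun g i) + m < p.+2)%N.
Proof. by rewrite spread_ffunE spread_bound. Qed.

(** With one point at 0, opening the circle there turns cyclic separation into
    separation on a line that ends with m free places; spread_ffun is then a
    bijection from the pinned injections, with inverse squeeze. *)
Lemma card_pinned_cyclic_separated :
  #|[set f | cyclic_separated f && (f i0 == 0)]| =
    ((p.+1 - m * #|K|) ^_ #|K|.-1)%N.
Proof.
rewrite -(@card_pinned_injections K M i0).
have spread_inj : injective spread_ffun.
  move=> g h gh; apply/ffunP => i; apply: val_inj.
  rewrite -[LHS](@spreadK K m (fun j => val (g j))).
  rewrite -[RHS](@spreadK K m (fun j => val (h j))).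
  have e j : spread m (fun j => val (g j)) j = spread m (fun j => val (h j)) j.
    by rewrite -!spread_ffunE gh.
  rewrite /squeeze e (@rank_mono _ _ (spread m (fun j => val (h j)))) // => a b.
  by rewrite !e.
rewrite -(card_imset _ spread_inj); apply: eq_card => f.
rewrite inE; apply/andP/imsetP => [[/cyclic_separatedP sepf /eqP f0]|[g + ->]].
  pose f' i := val (f i).
  have f'0 : f' i0 = 0%N by rewrite /f' f0.
  have injf : injective f'.
    move=> i j /val_inj fij; apply/eqP/negPn/negP => neq.
    by have := sepf i j 0%N neq isT; rewrite fij subrr eqxx.
  have sepf' : separated m f'.
    move=> i j ltij; rewrite ltnNge; apply/negP => leij.
    have neq : j != i by apply: contraTneq ltij => ->; rewrite ltnn.
    have : (f' j - f' i <= m)%N by lia.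
    move/(sepf j i _ neq)/negP; apply; rewrite subr_natrP /f' in ltij leij *.
      by rewrite subnKC ?eqxx // ltnW.
    by have := ltn_ord (f j); rewrite /=; lia.
  have boundf i : (f' i + m < p.+2)%N.
    rewrite ltnNge; apply/negP => lei.
    have [eqi|neq] := eqVneq i0 i.
      by move: lei; rewrite -eqi f'0; lia.
    have lti := ltn_ord (f i).
    have : (p.+2 - f' i <= m)%N by rewrite leq_subLR.
    move/(sepf i0 i _ neq)/negP; apply.
    have pos : (0 < f' i)%N by rewrite lt0n -f'0 (inj_eq injf) eq_sym.
    rewrite subr_natrP; last by rewrite ltn_subrL pos.
    by rewrite -/(f' i0) -/(f' i) f'0 (subnKC (ltnW lti)) eqxx orbT.
  have squeezelt i : (squeeze m f' i < M.+1)%N.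
    have := squeeze_bound injf sepf' f'0 i boundf; rewrite /M; lia.
  pose g : {ffun K -> 'I_M.+1} := [ffun i => inord (squeeze m f' i)].
  have gE i : val (g i) = squeeze m f' i by rewrite ffunE /= inordK.
  exists g.
    rewrite inE; apply/andP; split.
      apply/injectiveP => i j gij; apply: (injf); apply/eqP.
      have := squeeze_mono injf sepf' f'0 i j.
      have := squeeze_mono injf sepf' f'0 j i.
      by rewrite -!gE gij; lia.
    by apply/eqP/val_inj; rewrite gE /squeeze f'0.
  apply/ffunP=> i; apply: val_inj; rewrite spread_ffunE -[LHS]/(f' i).
  rewrite -(squeezeK injf sepf' f'0 i) /spread gE.
  by congr (_ + _ * _)%N; apply: eq_card => j; rewrite !inE !gE.
rewrite inE => /andP[/injectiveP injg /eqP g0]; split.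
  apply/cyclic_separatedP => i j s neq lesm.
  have neqg : val (g i) != val (g j) by rewrite (inj_eq val_inj) (inj_eq injg).
  have bj := spread_ffun_bound g j; have bi := spread_ffun_bound g i.
  rewrite subr_natrP; last lia.
  have := @spread_lt K m (fun j => val (g j)) i j.
  have := @spread_lt K m (fun j => val (g j)) j i.
  rewrite -!spread_ffunE; lia.
by apply/eqP/val_inj; rewrite spread_ffunE /spread rank0 ?g0 ?muln0.
Qed.
End Pinned.

Lemma card_cyclic_separated : (0 < #|K|)%N -> (m * #|K| + m < p.+2)%N ->
  #|[set f | cyclic_separated f]| =
    (p.+2 * (p.+1 - m * #|K|) ^_ #|K|.-1)%N.
Proof.
move=> /card_gt0P[i0 _] large; rewrite -(card_pinned_cyclic_separated i0 large).
rewrite (card_pinned i0) ?card_ord // => f c.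
by apply: eq_forallb => i; apply: eq_forallb => j; apply: eq_forallb => s;
  rewrite !ffunE opprD addrACA subrr addr0.
Qed.
End Cyclic.

(** * Points avoiding the equations, by fibres *)

Section Kernel.
Variables (T : finType) (e : rel T) (m p : nat).
Hypothesis large : (m * #|T| + m < p.+2)%N.
Implicit Types x : {ffun T -> 'I_p.+2}.
Implicit Types P : {set {set T}}.

Definition avoiding x :=
  [forall i, forall j, forall s : 'I_m.+1,
     (i != j) && ((0 < s)%N || ~~ e i j) ==> (x i - x j != s%:R)].

Lemma avoidingP x :
  reflect (forall i j s, i != j -> (s <= m)%N -> (0 < s)%N || ~~ e i j ->
             x i - x j != s%:R)
          (avoiding x).
Proof.
apply: (iffP idP) => [/forallP avx i j s neq lesm cond|avx].
  have /forallP/(_ (Ordinal (lesm : (s < m.+1)%N))) := forallP (avx i) j.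
  by rewrite neq /= cond.
apply/forallP=> i; apply/forallP=> j; apply/forallP=> s; apply/implyP=> /andP[neq cond].
by apply: avx; rewrite // -ltnS.
Qed.

Definition kernel x : {set {set T}} := preim_partition x [set: T].

Definition independent_partition P :=
  partition P [set: T] && [forall B in P, independent (compl_graph e) B].

Lemma kernelP x P : partition P [set: T] ->
  reflect (forall i j, (j \in pblock P i) = (x i == x j)) (kernel x == P).
Proof.
move=> partP; have /and3P[/eqP covP trivP _] := partP.
have cov i : i \in cover P by rewrite covP inE.
apply: (iffP eqP) => [<- i j|blockP].
  rewrite /kernel /preim_partition pblock_equivalence_partition ?inE //.
  by split=> // /eqP->.
rewrite -[RHS](equivalence_partition_pblock partP).
rewrite /kernel /preim_partition /equivalence_partition.
apply: eq_imset => i; apply/setP=> j; by rewrite !inE blockP.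
Qed.

Lemma card_blocks P : partition P [set: T] -> (#|P| <= #|T|)%N.
Proof.
move=> partP; rewrite -cardsT (card_partition partP) -sum1_card.
by apply: leq_sum => B BP; rewrite card_gt0 (partition_neq0 partP).
Qed.

Lemma kernel_independent x : avoiding x -> independent_partition (kernel x).
Proof.
move/avoidingP=> avx.
have part : partition (kernel x) [set: T] by exact: preim_partitionP.
rewrite /independent_partition part /=.
apply/forall_inP => B BP; apply/forall_inP => i iB; apply/forall_inP => j jB.
apply/negP => /andP[neq nadj].
have /and3P[_ trivP _] := part.
have : j \in pblock (kernel x) i by rewrite (def_pblock trivP BP iB).
rewrite (kernelP x part _) // => /eqP xij.
by have := avx i j 0%N neq isT nadj; rewrite xij subrr eqxx.
Qed.

(** The x with kernel P factor through the set of blocks of P.  Within a block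
    the avoided equations are x_i - x_j = s with 1 <= s <= m only, since its
    elements are adjacent in e, and these never hold; between two blocks the
    equation x_i = x_j is excluded by the kernel even for adjacent i and j.
    So the map on blocks is cyclically separated, and conversely. *)
Lemma card_kernel_fiber P : independent_partition P -> (0 < #|T|)%N ->
  #|[set x | avoiding x && (kernel x == P)]| =
    (p.+2 * (p.+1 - m * #|P|) ^_ #|P|.-1)%N.
Proof.
move=> /andP[partP /forall_inP indP] T0.
have /and3P[/eqP covP trivP nset0] := partP.
have cov i : i \in cover P by rewrite covP inE.
pose K : finType := {B : {set T} | B \in P}.
have cardK : #|K| = #|P| by rewrite card_sig; apply: eq_card.
pose block i : K := exist _ (pblock P i) (pblock_mem (cov i)).
have blockE i j : (block i == block j) = (j \in pblock P i).
  by rewrite -(inj_eq val_inj) /= eq_pblock.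
have P0 : (0 < #|K|)%N.
  by have /card_gt0P[i _] := T0; apply/card_gt0P; exists (block i).
rewrite -cardK -card_cyclic_separated //; last first.
  by rewrite cardK (leq_ltn_trans _ large) // leq_add2r leq_mul2l card_blocks ?orbT.
pose pull (f : {ffun K -> 'I_p.+2}) : {ffun T -> 'I_p.+2} := [ffun i => f (block i)].
have blockS (B : K) : exists i, block i == B.
  have [B0|[i iB]] := set_0Vmem (val B).
    by move: nset0; rewrite -B0 (valP B).
  by exists i; rewrite -(inj_eq val_inj) /= (def_pblock trivP (valP B) iB).
have pull_inj : injective pull.
  move=> f g /ffunP fg; apply/ffunP => B; have [i /eqP <-] := blockS B.
  by have := fg i; rewrite !ffunE.
rewrite -(card_imset _ pull_inj); apply: eq_card => x.
rewrite inE; apply/andP/imsetP => [[/avoidingP avx /kernelP-/(_ partP) kerx]|[f]].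
  exists [ffun B => x (xchoose (blockS B))]; last first.
    apply/ffunP=> i; rewrite !ffunE; apply/eqP; rewrite -kerx -blockE eq_sym.
    exact: xchooseP (blockS (block i)).
  rewrite inE; apply/cyclic_separatedP => B C s neq lesm; rewrite !ffunE.
  move: neq; rewrite -{1}(eqP (xchooseP (blockS B))) -{1}(eqP (xchooseP (blockS C))).
  move: (xchoose _) (xchoose _) => i j; rewrite blockE kerx => neq.
  case: s lesm => [_|s lesm]; first by rewrite subr_eq0.
  by apply: avx => //; apply: contraNneq neq => ->.
rewrite inE => /cyclic_separatedP sepf ->; split.
  apply/avoidingP => i j s neq lesm cond; rewrite !ffunE.
  have [eqB|neqB] := eqVneq (block i) (block j); last exact: sepf.
  have jB : j \in pblock P i by rewrite -blockE eqB.
  have iB : i \in pblock P i by rewrite mem_pblock.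
  have /forall_inP/(_ i iB)/forall_inP/(_ j jB) := indP _ (pblock_mem (cov i)).
  rewrite /compl_graph neq /= negbK => adj; rewrite adj orbF in cond.
  rewrite eqB subrr eq_sym -(inj_eq val_inj) val_natr -?lt0n //.
  by rewrite (leq_ltn_trans lesm) // (leq_ltn_trans _ large) // leq_addl.
apply/kernelP => // i j; rewrite -blockE !ffunE; apply/eqP/eqP => [->//|eqf].
apply/eqP/negPn/negP => neqB.
by have := sepf _ _ 0%N neqB isT; rewrite eqf subrr eqxx.
Qed.

Lemma card_avoiding : (0 < #|T|)%N ->
  #|[set x | avoiding x]| =
    (\sum_(1 <= k < #|T|.+1)
       Stir k (compl_graph e) * (p.+2 * (p.+1 - m * k) ^_ k.-1))%N.
Proof.
move=> T0; rewrite -sum1dep_card.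
rewrite (partition_big kernel independent_partition) /=; last first.
  exact: kernel_independent.
transitivity (\sum_(P | independent_partition P)
                 (p.+2 * (p.+1 - m * #|P|) ^_ #|P|.-1))%N.
  by apply: eq_bigr => P indP; rewrite sum1dep_card card_kernel_fiber.
under eq_bigr => P indP.
  have /andP[partP _] := indP.
  have P0 : (0 < #|P|)%N.
    have /card_gt0P[i _] := T0; apply/card_gt0P; exists (pblock P i).
    by rewrite pblock_mem // (cover_partition partP) inE.
  rewrite (_ : (_ * _)%N = \sum_(1 <= k < #|T|.+1 | k == #|P|)
                              (p.+2 * (p.+1 - m * k) ^_ k.-1))%N; last first.
    by rewrite big_nat1_eq P0 ltnS card_blocks.
  over.
rewrite (exchange_big_dep xpredT) //=; apply: eq_bigr => k _.
rewrite sum_nat_const; congr (_ * _)%N.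
apply: eq_card => P; rewrite inE unfold_in /independent_partition -andbA.
by rewrite [k == _]eq_sym [(_ == k) && _]andbC.
Qed.
End Kernel.

(** * Möbius function and points off the hyperplanes *)

Lemma moebius_sum {d} {P : finPOrderType d} (x y : P) : (x <= y)%O ->
  \sum_(z : P | (x <= z <= y)%O) moebius x z = (x == y)%:R.
Proof.
move=> xy; rewrite (bigD1 y) /= ?xy ?lexx // moebiusE.
under eq_bigl => z do rewrite -andbA [(z <= y)%O && _]andbC -lt_neqAle.
have [<-|neq_xy] := eqVneq x y.
  by rewrite big_pred0 ?addr0 // => z; case: comparableP.
by rewrite lt_neqAle neq_xy xy addNr.
Qed.

Section PointCount.
Context {R : realFieldType} {n : nat}.
Implicit Types (A : arrangement R n) (y : 'rV[R]_n).

Lemma flatsP A (X : set 'rV[R]_n) : X \in flats A ->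
  exists2 B : {fset set 'rV[R]_n}, (B `<=` A)%fset &
    X = (\bigcap_(H in [set` B]) H)%classic /\ (X !=set0)%classic.
Proof.
rewrite !inE => /andP[/imfsetP[B /=]]; rewrite fpowersetE => BA -> /asboolP X0.
by exists B.
Qed.

(** The flats containing y are the flats below the intersection Y of all
    hyperplanes through y, and Y is the bottom exactly when there is no such
    hyperplane. *)
Lemma moebius_sum_point A y :
    (forall H, H \in A -> H <> [set: _]%classic) ->
  \sum_(X : intersection_poset A | `[< val X y >]) moebius \bot%O X =
    (`[< forall H, H \in A -> ~ H y >])%:R.
Proof.
move=> properA.
pose B := [fset H in A | `[< H y >]]%fset.
pose Yset : set 'rV[R]_n := (\bigcap_(H in [set` B]) H)%classic.
have Yy : Yset y by move=> H /=; rewrite !inE => /andP[_ /asboolP].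
have Yflat : Yset \in flats A.
  rewrite !inE; apply/andP; split; last by apply/asboolP; exists y.
  apply/imfsetP; exists B => //=; rewrite fpowersetE.
  by apply/fsubsetP => H; rewrite !inE => /andP[].
pose Y : intersection_poset A := [` Yflat]%fset.
have leY (X : intersection_poset A) : `[< val X y >] = (\bot <= X <= Y)%O.
  rewrite le0x /=; apply/asboolP/asboolP => [Xy|/(_ y)]; last exact.
  have [C CA [XE _]] := flatsP (valP X).
  have {}Xy : (\bigcap_(H in [set` C]) H)%classic y by rewrite -XE.
  move=> z Yz; suff : (\bigcap_(H in [set` C]) H)%classic z by rewrite -XE.
  move=> H /= HC; apply: Yz => /=; rewrite !inE.
  by rewrite (fsubsetP CA _ HC); apply/asboolP/(Xy H HC).
under eq_bigl => X do rewrite leY.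
rewrite moebius_sum ?le0x //; congr (nat_of_bool _)%:R.
apply/eqP/asboolP => [Y0 H HA Hy|noH].
  apply: (properA H HA); apply/seteqP; split=> // z _.
  have : val Y z by rewrite -Y0.
  by apply; rewrite /= !inE HA; apply/asboolP.
apply/val_inj => /=; apply/esym/seteqP; split=> // z _ H /=.
by rewrite !inE => /andP[HA /asboolP /(noH _ HA)].
Qed.

(** The finite field method, freed from the finite field: S may be any finite
    family of points that meets every flat of dimension d in q^d points. *)
Lemma characteristic_poly_count A (S : finType) (q : nat) (f : S -> 'rV[R]_n) :
    (forall H, H \in A -> H <> [set: _]%classic) ->
    (forall X, X \in flats A -> #|[set x | `[< X (f x) >]]| = (q ^ affine_dim X)%N) ->
  (characteristic_poly A).[q%:R] =
    #|[set x | `[< forall H, H \in A -> ~ H (f x) >]]|%:R.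
Proof.
move=> properA cardX; rewrite /characteristic_poly horner_sum.
transitivity (\sum_(x : S) \sum_(X : intersection_poset A | `[< val X (f x) >])
                 moebius \bot%O X).
  rewrite (exchange_big_dep xpredT) //=; apply: eq_bigr => X _.
  rewrite hornerZ hornerXn -natrX -(cardX _ (valP X)) sumr_const -[RHS]mulr_natr.
  by congr (_ * _%:R); apply: eq_card => x; rewrite !inE.
under eq_bigr => x _ do rewrite moebius_sum_point //.
rewrite -natr_sum -sum1dep_card [in RHS]big_mkcond /=.
by congr _%:R; apply: eq_bigr => x _; case: asboolP.
Qed.
End PointCount.

(** * Vectors constant on the components of a graph *)

(** One retraction r, which sends each vertex to a representative of its
    component, serves for all value types V: it is used both over the reals,
    for the dimension of a flat, and modulo q, for the number of its points. *)
Lemma component_root (T : finType) (g : rel T) : exists2 r : T -> T,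
  (forall i, r (r i) = r i) &
  forall (V : Type) (f : T -> V),
    (forall i j, g i j -> f i = f j) <-> (forall i, f i = f (r i)).
Proof.
pose g' := [rel i j | g i j || g j i].
have symg : connect_sym g' by apply: sym_connect_sym => i j /=; rewrite orbC.
exists (fingraph.root g') => [i|V f]; first exact: root_root.
split=> [constf i|rootf i j gij].
  have /connectP[s paths ->] := connect_root g' i.
  elim: s i paths => //= j s IHs i /andP[gij /IHs <-].
  by have /orP[/constf|/constf] := gij.
rewrite rootf [f j]rootf; congr f; apply/eqP; rewrite root_connect //.
by apply: connect1; rewrite /= gij.
Qed.

Section Retraction.
Variables (T : finType) (r : T -> T).
Hypothesis rK : forall i, r (r i) = r i.

Lemma card_constant_fibers (V : finZmodType) :
  #|[set z : {ffun T -> V} | [forall i, z i == z (r i)]]| =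
    (#|V| ^ #|[pred i | r i == i]|)%N.
Proof.
rewrite -[#|V|]/#|predT| -(card_pffun_on 0).
set D := [pred i | r i == i].
pose ext (h : {ffun T -> V}) : {ffun T -> V} := [ffun i => h (r i)].
have ext_inj : {in pffun_on 0 D predT &, injective ext}.
  move=> h h' /pffun_onP[/supportP supp _] /pffun_onP[/supportP supp' _] /ffunP eqh.
  apply/ffunP=> i; have [/eqP ri|niD] := boolP (i \in D).
    by have := eqh i; rewrite !ffunE ri.
  by rewrite supp ?supp'.
rewrite -(card_in_imset ext_inj); apply: eq_card => z.
rewrite inE; apply/forallP/imsetP => [zr|[h _ ->] i]; last first.
  by rewrite !ffunE rK.
exists [ffun i => if i \in D then z i else 0]; last first.
  by apply/ffunP=> i; rewrite !ffunE inE rK eqxx (eqP (zr i)).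
apply/pffun_onP; split=> //; apply/supportP=> i niD; by rewrite ffunE (negbTE niD).
Qed.
End Retraction.

Lemma dim_constant_fibers (F : fieldType) (n : nat) (r : 'I_n -> 'I_n) :
    (forall i, r (r i) = r i) ->
  exists2 U : {vspace 'rV[F]_n},
    (forall u : 'rV[F]_n, u \in U <-> forall i, u 0 i = u 0 (r i)) &
    \dim U = #|[pred i | r i == i]|.
Proof.
move=> rK; set D := [pred i | r i == i].
pose ind j : 'rV[F]_n := \row_i (r i == j)%:R.
pose B := map_tuple ind (enum_tuple D).
have BE (a : 'I_#|D|) : B`_a = ind (enum_val a).
  rewrite (nth_map (enum_val a)) /= -?cardE //.
  by rewrite [in RHS](enum_val_nth (enum_val a)).
have DP a : r (@enum_val _ D a) = enum_val a by apply/eqP/(enum_valP a).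
have sumB (k : 'I_#|D| -> F) (a : 'I_#|D|) i : r i = enum_val a ->
    (\sum_b k b *: B`_b) 0 i = k a.
  move=> ri; rewrite summxE (bigD1 a) //= big1 => [|b neq]; rewrite BE !mxE ri.
    by rewrite eqxx mulr1 addr0.
  by rewrite (inj_eq enum_val_inj) eq_sym (negbTE neq) mulr0.
have freeB : free B.
  apply/freeP => k sum0 a.
  by rewrite -(sumB k a (enum_val a) (DP a)) sum0 mxE.
exists <<B>>%VS => [u|]; last by rewrite (eqP freeB) size_tuple.
split=> [/coord_span -> i|ur].
  by rewrite !summxE; apply: eq_bigr => a _; rewrite BE !mxE rK.
have -> : u = \sum_(a < #|D|) u 0 (enum_val a) *: B`_a.
  apply/rowP => i; have Dri : r i \in D by rewrite inE rK.
  rewrite (sumB (fun a => u 0 (enum_val a)) (enum_rank_in Dri (r i))).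
    by rewrite enum_rankK_in // -ur.
  by rewrite enum_rankK_in.
by apply: memv_suml => a _; rewrite memvZ // memv_span // mem_nth // size_tuple.
Qed.

(** * Dimension and lattice points of flats *)

(** The direction space of X is unique: x and x' in X differ by an element of
    it, whatever point of X is taken as origin. *)
Lemma affine_dim_translate (R : realFieldType) (n : nat) (X : set 'rV[R]_n)
    (U : {vspace 'rV[R]_n}) (p : 'rV[R]_n) :
  (forall x, X x <-> x - p \in U) -> affine_dim X = \dim U.
Proof.
move=> XU; rewrite /affine_dim (@xget_unique _ _ _ U) //.
  exists p; apply/seteqP; split=> [x /XU xU|_ [u uU <-]].
    by exists (x - p) => //; rewrite addrC subrK.
  by apply/XU; rewrite addrAC subrr add0r.
move=> U' [p' XE]; apply/vspaceP => u.
have XU' x : X x <-> x - p' \in U'.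
  rewrite XE; split=> [[v vU' <-]|xU']; first by rewrite addrAC subrr add0r.
  by exists (x - p') => //; rewrite addrC subrK.
have Xp : X p by apply/XU; rewrite subrr mem0v.
have Xp' : X p' by apply/XU'; rewrite subrr mem0v.
apply/idP/idP => uU.
  have /XU : X (p + u) by apply/XU'; rewrite addrAC rpredD //; apply/XU'.
  by rewrite addrAC subrr add0r.
have /XU' : X (p' + u) by apply/XU; rewrite addrAC rpredD //; apply/XU.
by rewrite addrAC subrr add0r.
Qed.

(** Each x i lies in m of the windows of m consecutive places, so some window,
    starting at c, contains no x i.  Read from c, all the x i then have
    coordinates at least m; a coordinate increased by s <= m that passes c
    ends inside the window, hence not at another x i. *)
Lemma cyclic_lift (T : finType) (m p : nat) (x : T -> 'I_p.+2) :
    (m * #|T| + m < p.+2)%N ->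
  exists y : T -> nat, forall i j s, (s <= m)%N ->
    (x i - x j == s%:R) = (y i == y j + s)%N.
Proof.
move=> large.
pose hit := codom (fun a : T * 'I_m => x a.1 - (val a.2)%:R).
have [c /negP c_free] : exists c, c \notin hit.
  apply/existsP; rewrite -negb_forall; apply/negP => /forallP hitT.
  have : (#|'I_p.+2| <= #|hit|)%N.
    by apply/subset_leq_card/fintype.subsetP => c _; apply: hitT.
  move/leq_trans/(_ (leq_image_card _ _)).
  by rewrite cardT -cardT card_prod !card_ord; lia.
exists (fun i => val (x i - c)) => i j s les.
have low k : (m <= val (x k - c)%R)%N.
  rewrite leqNgt; apply/negP => ltm; apply: c_free; apply/codomP.
  exists (k, Ordinal ltm).
  by rewrite [X in _ - X](natr_Zp (x k - c)) subKr.
have := low i; have := low j.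
have -> : x i - x j = (x i - c) - (x j - c) by rewrite opprB addrA subrK.
move: (x i - c) (x j - c) => a b; rewrite subr_natrP; last by lia.
by move: (ltn_ord a) (ltn_ord b) => /=; lia.
Qed.

Lemma subr_swap (V : zmodType) (a b c d : V) :
  (a - b == c - d) = (a - c == b - d).
Proof.
by rewrite -subr_eq0 -[RHS]subr_eq0 !opprB addrACA [- b + _]addrC addrACA.
Qed.

(** * The graph-deleted Catalan arrangement modulo q *)

Section GraphCatalan.
Variables (R : realType) (n m : nat) (e : rel 'I_n).
Hypothesis he : simple_graph e.
Notation hypR := (@hyp R n).
Notation A := (graph_catalan R m e).

Lemma hyp0C (i j : 'I_n) : hypR i j 0 = hypR j i 0.
Proof.
by apply/seteqP; split=> x; rewrite /hyp /= => /eqP; rewrite subr_eq0 => /eqP ->;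
  rewrite subrr.
Qed.

(** If k is not an end of the edge ab, the unit vector at k satisfies
    x_a = x_b but no equation x_k = x_l; hence both i and j are ends of ab. *)
Lemma hyp0_same_edge (i j a b : 'I_n) : i != j -> a != b ->
  hypR i j 0 = hypR a b 0 -> e a b -> e i j.
Proof.
move=> nij nab ijab eab.
have ends (k l : 'I_n) : k != l -> hypR k l 0 = hypR a b 0 -> (k == a) || (k == b).
  move=> nkl klab; apply: contraNT nkl; rewrite negb_or => /andP[nka nkb].
  have : hypR k l 0 (delta_mx 0 k).
    rewrite klab /hyp /= !mxE !eqxx /= eq_sym (negbTE nka).
    by rewrite eq_sym (negbTE nkb) subrr.
  rewrite /hyp /= !mxE !eqxx /= [l == k]eq_sym.
  by case: eqP => // _ /eqP; rewrite subr0 oner_eq0.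
have := ends i j nij ijab; have := ends j i; rewrite eq_sym hyp0C => /(_ nij ijab).
case/orP=> /eqP ej /orP[]/eqP ei; move: nij; rewrite ei ej ?eqxx // => _.
by rewrite he.1.
Qed.

(** Deleting the hyperplanes x_i = x_j as sets removes nothing else: those
    with s > 0 miss the origin, and a hyperplane x_i = x_j determines {i, j}. *)
Lemma graph_catalanP H : H \in A <->
  exists i j s, [/\ i != j, (s <= m)%N, (0 < s)%N || ~~ e i j & H = hypR i j s].
Proof.
have [syme irre] := he.
rewrite inE; split=> [/andP[noedge]|[i [j [s [nij les cond ->]]]]].
  rewrite inE => /orP[|].
    case/imfset2P => i _ [j]; rewrite inE => ltij HE.
    exists i, j, 0%N; split=> //.
      by apply: contraTneq ltij => ->; rewrite ltnn.
    by apply: contraNN noedge => eij; apply/imfset2P; exists i => //; exists j.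
  move=> /bigfcupP[s]; rewrite mem_iota andbT => /andP[s0 sm].
  case/imfset2P => i _ [j]; rewrite inE => nij HE.
  by exists i, j, s; split=> //; rewrite ?s0 //; lia.
apply/andP; split.
  apply/negP => /imfset2P[a _ [b]]; rewrite inE /= => eab ijab.
  have nab : a != b by apply: contraTneq eab => ->; rewrite irre.
  case: s les cond ijab => [_ /= nadj ijab|s _ _ ijab].
    by rewrite (hyp0_same_edge nij nab ijab eab) in nadj.
  have : hypR i j s.+1 0 by rewrite ijab /hyp /= !mxE subrr.
  by rewrite /hyp /= !mxE subrr => /esym/eqP; rewrite pnatr_eq0.
rewrite inE; apply/orP; case: s les cond => [_ _|s les _]; [left|right].
  apply/imfset2P; have : (i != j :> nat) by [].
  rewrite neq_ltn => /orP[ltij|ltji]; first by exists i => //; exists j.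
  by exists j => //; exists i => //; rewrite hyp0C.
apply/bigfcupP; exists s.+1; first by rewrite mem_iota andbT; lia.
by apply/imfset2P; exists i => //; exists j.
Qed.

Lemma graph_catalan_proper H : H \in A -> H <> [set: _]%classic.
Proof.
case/graph_catalanP => i [j [s [nij _ _ ->]]] full.
have := I : [set: 'rV[R]_n]%classic (- delta_mx 0 i); rewrite -full /hyp /=.
rewrite !mxE !eqxx /= [j == i]eq_sym (negbTE nij) oppr0 subr0 => neg1.
have := ler0n R s; rewrite -neg1 lerNr oppr0; apply/negP.
by rewrite -ltNge ltr01.
Qed.

Section Modular.
Variable p : nat.
Hypothesis large : (m * n + m < p.+2)%N.

(** Both the real points of X and the x with y x in X are the translates of the
    vectors that are constant on the components of the graph of the equations
    of X; only the base points pt and x0 differ. *)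
Lemma flat_count (y : {ffun 'I_n -> 'I_p.+2} -> 'rV[R]_n) :
    (forall x i j s, (s <= m)%N -> hypR i j s (y x) <-> x i - x j = s%:R) ->
  forall X, X \in flats A ->
    #|finset (fun x => `[< X (y x) >])| = (p.+2 ^ affine_dim X)%N.
Proof.
move=> yE X /flatsP[C /fsubsetP CA [XE [pt Xpt]]].
have XP z : X z <-> forall i j s, (s <= m)%N -> hypR i j s \in C -> hypR i j s z.
  rewrite XE; split=> [Cz i j s _ HC|Cz H /= HC]; first exact: Cz HC.
  have /graph_catalanP[i [j [s [_ les _ HE]]]] := CA _ HC.
  by rewrite HE in HC *; apply: Cz.
pose g i j := [exists s : 'I_m.+1, hypR i j s \in C].
have [r rK rP] := component_root g.
have ptE i j s : (s <= m)%N -> hypR i j s \in C -> pt 0 i - pt 0 j = s%:R.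
  by move=> les HC; apply: (XP pt).1.
have dimX : affine_dim X = #|[pred i | r i == i]|.
  have [U UP <-] := @dim_constant_fibers R n r rK.
  apply: (@affine_dim_translate _ _ _ _ pt) => z.
  rewrite UP -(rP R (fun i => (z - pt) 0 i)) XP; split=> [Cz i j|gz i j s les HC].
    case/existsP=> s HC; have les : (s <= m)%N by rewrite -ltnS.
    have := Cz i j s les HC; rewrite /hyp /= !mxE -(ptE i j s les HC) => /eqP.
    by rewrite subr_swap => /eqP.
  have : g i j by apply/existsP; exists (Ordinal (les : (s < m.+1)%N)).
  move/gz; rewrite !mxE /hyp /= -(ptE i j s les HC) => /eqP.
  by rewrite subr_swap => /eqP.
(* A flat is cut out by integral equations, so it contains the integral part of
   its point pt, which can be reduced modulo p.+2. *)
pose x0 i : 'I_p.+2 := (Num.floor (pt 0 i))%:~R.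
have x0E i j s : (s <= m)%N -> hypR i j s \in C -> x0 i - x0 j = s%:R.
  move=> les HC; rewrite /x0 -(subrK (pt 0 j) (pt 0 i)) (ptE i j s) //.
  by rewrite floorDzr ?natr_int // -[s%:R]/(s%:Z%:~R) intrKfloor intrD addrK.
have constX (x : {ffun 'I_n -> 'I_p.+2}) :
    `[< X (y x) >] = [forall i, x i - x0 i == x (r i) - x0 (r i)].
  apply/asboolP/forallP => [/XP Cx i|constx].
    apply/eqP; move: i; apply/(rP _ (fun i => x i - x0 i)) => i j.
    case/existsP=> s HC; have les : (s <= m)%N by rewrite -ltnS.
    have := (yE _ _ _ _ les).1 (Cx i j s les HC); rewrite -(x0E i j s les HC).
    by move/eqP; rewrite subr_swap => /eqP.
  apply/XP => i j s les HC; apply/(yE _ _ _ _ les); rewrite -(x0E i j s les HC).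
  have : g i j by apply/existsP; exists (Ordinal (les : (s < m.+1)%N)).
  have /(rP _ (fun i => x i - x0 i)) rx : forall i, x i - x0 i = x (r i) - x0 (r i).
    by move=> k; apply/eqP.
  by move/rx/eqP; rewrite subr_swap => /eqP.
rewrite dimX; have := card_constant_fibers rK 'I_p.+2; rewrite card_ord => <-.
pose shift (z : {ffun 'I_n -> 'I_p.+2}) : {ffun 'I_n -> 'I_p.+2} :=
  [ffun i => z i + x0 i].
have shift_inj : injective shift.
  by move=> z z' /ffunP eqz; apply/ffunP=> i; have := eqz i; rewrite !ffunE => /addIr.
rewrite -[RHS](card_imset _ shift_inj); apply: eq_card => x; rewrite inE constX.
apply/forallP/imsetP => [constx|[z]].
  exists [ffun i => x i - x0 i].
    by rewrite inE; apply/forallP => i; rewrite !ffunE.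
  by apply/ffunP=> i; rewrite !ffunE subrK.
by rewrite inE => /forallP constz -> i; rewrite !ffunE !addrK.
Qed.

Lemma graph_catalan_eval : (0 < n)%N ->
  (characteristic_poly A).[p.+2%:R] =
    (\sum_(1 <= k < n.+1)
       Stir k (compl_graph e) * (p.+2 * (p.+1 - m * k) ^_ k.-1))%:R.
Proof.
move=> n0; have largeT : (m * #|'I_n| + m < p.+2)%N by rewrite card_ord.
have liftP := fun x : {ffun 'I_n -> 'I_p.+2} => svalP (cid (cyclic_lift x largeT)).
pose y (x : {ffun 'I_n -> 'I_p.+2}) : 'rV[R]_n :=
  \row_i (sval (cid (cyclic_lift x largeT)) i)%:R.
have yE x i j s : (s <= m)%N -> hypR i j s (y x) <-> x i - x j = s%:R.
  move=> les; rewrite /hyp /= !mxE.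
  have := liftP x i j s les; move: (sval _) => h xh.
  split=> /eqP; first by rewrite subr_eq addrC -natrD eqr_nat -xh => /eqP.
  by rewrite xh => /eqP ->; rewrite natrD addrAC subrr add0r.
rewrite (@characteristic_poly_count _ _ _ _ _ y).
- congr _%:R; have := @card_avoiding 'I_n e m p largeT; rewrite card_ord => <- //.
  apply: eq_card => x; rewrite !inE; apply/asboolP/avoidingP.
    move=> noH i j s nij les cond; apply/eqP => /(yE _ _ _ _ les).
    by apply: noH; apply/graph_catalanP; exists i, j, s.
  move=> avx H /graph_catalanP[i [j [s [nij les cond ->]]]] /(yE _ _ _ _ les)/eqP.
  by apply/negP; apply: avx.
- exact: graph_catalan_proper.
- exact: flat_count.
Qed.
End Modular.
End GraphCatalan.

(** * Comparison of the two polynomials *)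

Lemma eq_poly_nat (f g : {poly int}) (N : nat) :
  (forall q, (N <= q)%N -> f.[q%:R] = g.[q%:R]) -> f = g.
Proof.
move=> fg; apply/eqP; rewrite -subr_eq0; apply/negPn/negP => nz.
pose s : seq int := [seq q%:R | q <- iota N (size (f - g))].
have : (size s < size (f - g)%R)%N.
  apply: max_poly_roots => //.
    apply/allP => v /mapP[q]; rewrite mem_iota => /andP[Nq _] ->.
    by rewrite /root hornerD hornerN fg // subrr.
  by rewrite map_inj_uniq ?iota_uniq // => a b /eqP; rewrite eqr_nat => /eqP.
by rewrite size_map size_iota ltnn.
Qed.

Lemma horner_falling (f : {poly int}) (a : int) r :
  (falling f r).[a] = falling f.[a] r.
Proof.
rewrite /falling horner_prod; apply: eq_bigr => i _.
by rewrite hornerD hornerN hornerMn hornerC.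
Qed.

Lemma falling_natr (a r : nat) : (r <= a)%N -> falling (a%:R : int) r = (a ^_ r)%:R.
Proof.
move=> lera; rewrite /falling ffact_prod natr_prod; apply: eq_bigr => i _.
by rewrite natrB // (leq_trans (ltnW (ltn_ord i))).
Qed.

Theorem theorem1 (R : realType) (n m : nat) (e : rel 'I_n)
    (hn : (1 <= n)%N) (hm : (1 <= m)%N) (he : simple_graph e) :
  characteristic_poly (graph_catalan R m e) =
  'X * \sum_(1 <= k < n.+1)
         (Stir k (compl_graph e))%:R *
         falling ('X - (m * k)%:R - 1) k.-1 :> {poly int}.
Proof.
apply: (@eq_poly_nat _ _ (m * n + m + n + 2)) => -[|[|p]] large; try lia.
rewrite graph_catalan_eval //; last lia.
rewrite hornerM hornerX horner_sum natr_sum mulr_sumr.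
rewrite !big_nat; apply: eq_bigr => k /andP[k0 kn].
rewrite hornerM horner_falling [LHS]natrM [X in _ * X = _]natrM mulrCA.
congr (_ * (_ * _)).
  by rewrite -polyC_natr hornerC.
rewrite -falling_natr; last by nia.
rewrite !hornerD !hornerN hornerX -polyC_natr !hornerC; congr (falling _ _).
have mk : (m * k <= m * n)%N by rewrite leq_mul2l -ltnS kn orbT.
rewrite natrB; last lia.
by rewrite -[p.+2]addn1 natrD addrAC addrK.
Qed.
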